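(* Let $b\ge 4$ and $n\ge 1$ be integers, let $d$ be a positive integer with $d<b^{1/3}$, and let $c$ be an integer with $0\le c<d$ and $\gcd(c,d)=1$. Put $\alpha=\sqrt{b/d^3}$ and assume $\alpha\ge n^{3/2}+n$. Let $a$ be an integer with $\gcd(a,b)=1$ and $0<a-b\cdot c/d\le \alpha/n-1$. For each positive divisor $r$ of $n$ and $j\in\{0,\dots,r-1\}$ put $k(r,j)=\gcd(\frac nr a+jb, rb)$, $m(r,j)=\gcd(\frac nr c+jd, rd)$, $a(r,j)=(\frac nr a+jb)/k(r,j)$, $b(r,j)=rb/k(r,j)$, $c(r,j)=(\frac nr c+jd)/m(r,j)$, $d(r,j)=rd/m(r,j)$, $q(r,j)=a(r,j)d(r,j)-b(r,j)c(r,j)$ and $E[r,j]=\frac{b(r,j)}{d(r,j)q(r,j)}$; let also $E(a,b)=\frac{b}{d(ad-bc)}$. Then each $m(r,j)$ divides $n$. Conversely, for every positive divisor $m$ of $n$, $$\#\left\{(r,j):\ r\mid n,\ j\in\{0,\dots,r-1\},\ E[r,j]=\frac{m^2}{n}E(a,b)\right\}=\frac nm .$$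
   Context: Here $r$ ranges over positive divisors of $n$. The quantities $E(a,b)$ and $E[r,j]$ are the ''expected values'' of the normalized Dedekind sums $S(a,b)$ and $S(\frac nr a+jb, rb)$ near the Farey points $b\cdot c/d$ and $b(r,j)\cdot c(r,j)/d(r,j)$ respectively. *)

(* Defs.v *)
From mathcomp Require Import all_boot all_order all_algebra.
From mathcomp Require Import all_classical all_reals all_analysis.

Set Implicit Arguments.
Unset Strict Implicit.
Unset Printing Implicit Defensive.

Import GRing.Theory.
Local Open Scope ring_scope.

(* For r | n the vector (x, y) is sent to ((n/r) x + j y, r y); [fgcd], [fnum]
   and [fden] are the gcd of this pair and the two entries divided by it, so
     k(r,j) = fgcd n a b r j, a(r,j) = fnum n a b r j, b(r,j) = fden n a b r j,
     m(r,j) = fgcd n c d r j, c(r,j) = fnum n c d r j, d(r,j) = fden n c d r j.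
   Both divisions below are exact. *)
Definition fgcd (n : nat) (x y : int) (r j : nat) : int :=
  gcdz ((n %/ r)%N%:Z * x + j%:Z * y) (r%:Z * y).

Definition fnum (n : nat) (x y : int) (r j : nat) : int :=
  divz ((n %/ r)%N%:Z * x + j%:Z * y) (fgcd n x y r j).

Definition fden (n : nat) (x y : int) (r j : nat) : int :=
  divz (r%:Z * y) (fgcd n x y r j).

Definition fq (n : nat) (a b c d : int) (r j : nat) : int :=
  fnum n a b r j * fden n c d r j - fden n a b r j * fnum n c d r j.

Definition Eab (R : realType) (a b c d : int) : R :=
  b%:~R / (d * (a * d - b * c))%:~R.

Definition Erj (R : realType) (n : nat) (a b c d : int) (r j : nat) : R :=
  (fden n a b r j)%:~R / (fden n c d r j * fq n a b c d r j)%:~R.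

(* Main.v *)
Require Import Defs.
From mathcomp Require Import all_boot all_order all_algebra finmap.
From mathcomp Require Import all_classical all_reals all_analysis.
From mathcomp Require Import ring zify.

(** Since (n/r a + jb) rd - rb (n/r c + jd) = n (ad - bc), one has
    q(r,j) = n (ad - bc) / (k(r,j) m(r,j)) and E[r,j] = m(r,j)^2/n E(a,b), so the
    pairs (r,j) with m(r,j) = m have to be counted.  Such a pair is the Hermite
    normal form of a sublattice of index n in Z^2, with basis (n/r, j), (0, r),
    that the primitive functional (p, q) |-> pc + qd maps onto mZ.  The lattice
    contains (n/m) w, where w = (d, -c) spans the kernel of the functional, and
    some m u + t w, where u has value 1; it is determined by t modulo n/m.  Hence
    there are at most n/m such pairs.  Both the number of all pairs and the sum of
    these bounds are the sum of the divisors of n, so every bound is attained. *)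

Set Implicit Arguments. Unset Strict Implicit. Unset Printing Implicit Defensive.
Import Order.TTheory GRing.Theory Num.Theory.
Local Open Scope classical_set_scope.
Local Open Scope ring_scope.

(* In the basis u = (x, y), w = (d, -c) of Z^2 the rows (s, j) and (0, r) are
   (m A, s y - j x) and (m B, - r x).  The last hypothesis says that the vectors
   m u + t w, m u + t' w of the two lattices, found from the Bezout relations,
   have t = t' modulo N. *)
Lemma hnf_lattice_sub (c d x y m N s r j s' r' j' A B A' B' u v u' v' e : int) :
    m != 0 -> x * c + y * d = 1 -> s * r = m * N -> s' * r' = m * N ->
    s * c + j * d = m * A -> r * d = m * B -> u * A + v * B = 1 ->
    s' * c + j' * d = m * A' -> r' * d = m * B' -> u' * A' + v' * B' = 1 ->
    u * (s * y - j * x) - v * (r * x) =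
      u' * (s' * y - j' * x) - v' * (r' * x) + e * N ->
  (exists i l, s = i * s' /\ j = i * j' + l * r') /\
  (exists i l, 0 = i * s' /\ r = i * j' + l * r').
Proof.
move=> m0 xy srN srN' eA eB uv eA' eB' uv' et.
set b1 := s * y - j * x in et; set b2 := - (r * x).
set b1' := s' * y - j' * x in et; set b2' := - (r' * x).
(* The rows have coordinates [(m A, b1)] and [(m B, b2)], and the change of basis has determinant
   -1; comparing determinants with [s r = m N] and cancelling [m] gives this. *)
have detN : B * b1 - A * b2 = N.
  apply: (mulfI m0); rewrite -srN mulrBr !mulrA -eA -eB /b1 /b2.
  by rewrite -[RHS]mulr1 -xy; ring.
have detN' : B' * b1' - A' * b2' = N.
  apply: (mulfI m0); rewrite -srN' mulrBr !mulrA -eA' -eB' /b1' /b2'.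
  by rewrite -[RHS]mulr1 -xy; ring.
(* From [u A + v B = 1] and [detN], [b1 = A t + v N] and [b2 = B t - u N] with [t = u b1 + v b2];
   then [t = t' + e N] is substituted. *)
have eb1 : b1 = A * (u' * b1' + v' * b2') + (e * A + v) * N.
  have -> : u' * b1' + v' * b2' = u * b1 + v * b2 - e * N.
    by rewrite /b2 /b2' !mulrN et; ring.
  by rewrite -detN -[LHS]mul1r -uv; ring.
have eb2 : b2 = B * (u' * b1' + v' * b2') + (e * B - u) * N.
  have -> : u' * b1' + v' * b2' = u * b1 + v * b2 - e * N.
    by rewrite /b2 /b2' !mulrN et; ring.
  by rewrite -detN -[LHS]mul1r -uv; ring.
have es' : s' = x * (m * A') + d * b1'.
  by rewrite -eA' /b1' -[LHS]mulr1 -xy; ring.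
have ej' : j' = y * (m * A') - c * b1'.
  by rewrite -eA' /b1' -[LHS]mulr1 -xy; ring.
have es2' : 0 = x * (m * B') + d * b2' by rewrite -eB' /b2'; ring.
have er' : r' = y * (m * B') - c * b2'.
  by rewrite -eB' /b2' -[LHS]mulr1 -xy; ring.
have es : s = x * (m * A) + d * b1.
  by rewrite -eA /b1 -[LHS]mulr1 -xy; ring.
have ej : j = y * (m * A) - c * b1.
  by rewrite -eA /b1 -[LHS]mulr1 -xy; ring.
have es2 : 0 = x * (m * B) + d * b2 by rewrite -eB /b2; ring.
have er : r = y * (m * B) - c * b2.
  by rewrite -eB /b2 -[LHS]mulr1 -xy; ring.
(* Adds [l] times the zero entry of the row (0, r'), in expanded form, so that [ring] sees a full
   combination of both rows. *)
have si l i : i * s' = i * (x * (m * A') + d * b1') + l * (x * (m * B') + d * b2').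
  by rewrite -es2' mulr0 addr0 -es'.
split.
  (* In the primed lattice, the vector with coordinates [(m, t')] is the combination of the rows
     with coefficients [(u', v')], and [(0, N)] the one with [(B', - A')]. *)
  exists (A * u' + (e * A + v) * B'), (A * v' - (e * A + v) * A'); split.
    rewrite (si (A * v' - (e * A + v) * A')).
    by rewrite es eb1 -detN' -[m * A]mulr1 -uv'; ring.
  by rewrite ej ej' er' eb1 -detN' -[m * A]mulr1 -uv'; ring.
exists (B * u' + (e * B - u) * B'), (B * v' - (e * B - u) * A'); split.
  rewrite (si (B * v' - (e * B - u) * A')) {1}es2.
  by rewrite eb2 -detN' -[m * B]mulr1 -uv'; ring.
by rewrite er ej' er' eb2 -detN' -[m * B]mulr1 -uv'; ring.
Qed.

(** The lattice has index n, so it contains n (x, y), where the functional takes the value n; the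
    coefficients below express that vector in the basis (n/r, j), (0, r). *)
Lemma fgcd_dvd (n : nat) (c d : int) (r j : nat) :
  coprimez c d -> (r %| n)%N -> (fgcd n c d r j %| n%:Z)%Z.
Proof.
move=> /coprimezP[[x y] /= xy] rn.
have gA : (fgcd n c d r j %| (n %/ r)%N%:Z * c + j%:Z * d)%Z by exact: dvdz_gcdl.
have gB : (fgcd n c d r j %| r%:Z * d)%Z by exact: dvdz_gcdr.
have srn : (n %/ r)%N%:Z * r%:Z = n%:Z by rewrite -PoszM divnK.
have -> : n%:Z = x * r%:Z * ((n %/ r)%N%:Z * c + j%:Z * d)
    + (y * (n %/ r)%N%:Z - x * j%:Z) * (r%:Z * d).
  by rewrite -[LHS]mulr1 -xy -srn; ring.
by rewrite rpredD // dvdz_mull.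
Qed.

(** Positivity forces [i = i' = 0], so [r] and [r'] divide each other; the determinant then gives
    [s = s'], and [j - j'] is a multiple of [r] smaller than [r] in absolute value. *)
Lemma hnf_unique (s r j s' r' j' i l i' l' i2 l2 : int) :
    0 < s -> 0 < r -> 0 < r' -> 0 < s' -> 0 <= j < r -> 0 <= j' < r' ->
    0 = i * s' -> r = i * j' + l * r' ->
    0 = i' * s -> r' = i' * j + l' * r ->
    s * r = s' * r' ->
    s = i2 * s' -> j = i2 * j' + l2 * r' ->
  r = r' /\ j = j'.
Proof.
move=> s0 r0 r'0 s'0 jr jr' ei er ei' er' sr es ej.
have i0 : i = 0 by nia.
have i'0 : i' = 0 by nia.
rewrite {}i0 mul0r add0r in er; rewrite {}i'0 mul0r add0r in er'.
have l0 : 0 < l by nia.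
have l'0 : 0 < l' by nia.
have rr' : r = r' by nia.
rewrite -rr' in sr ej jr'; have ss' : s = s' by apply: (mulIf _ sr); lia.
have i21 : i2 = 1 by rewrite -ss' in es; apply: (@mulIf _ s); lia.
rewrite {}i21 mul1r in ej; have l20 : l2 = 0 by nia.
by split=> //; rewrite ej l20 mul0r addr0.
Qed.

(* The class t modulo n/m of the vector m u + t w in the lattice of p = (r, j),
   where u = (x, y) and w = (d, -c). *)
Definition hnf_coord (x y : int) (n : nat) (c d : int) (m : nat)
    (p : nat * nat) : nat :=
  let s := (n %/ p.1)%N%:Z in let r := p.1%:Z in let j := p.2%:Z in
  let uv := egcdz (s * c + j * d) (r * d) in
  `|((uv.1 * (s * y - j * x) - uv.2 * (r * x)) %% (n %/ m)%N%:Z)%Z|%N.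

Definition hnf_pairs (n : nat) : seq (nat * nat) :=
  [seq (r, j) | r <- divisors n, j <- iota 0 r].

Lemma mem_hnf_pairs (n r j : nat) :
  (0 < n)%N -> ((r, j) \in hnf_pairs n) = (r %| n)%N && (j < r)%N.
Proof.
move=> n0; rewrite dvdn_divisors //; apply/allpairsPdep/andP.
  by move=> [r' [j' [+ + [-> ->]]]]; rewrite mem_iota => -> /andP[_ ->].
by move=> [rn jr]; exists r, j; rewrite mem_iota.
Qed.

Lemma hnf_pairs_uniq (n : nat) : uniq (hnf_pairs n).
Proof.
apply: allpairs_uniq_dep; [exact: divisors_uniq|by move=> *; exact: iota_uniq|].
by move=> [? ?] [? ?] _ _ /= [-> ->].
Qed.

Lemma fgcd_bezout (n m : nat) (c d : int) (r j : nat) :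
  let s := (n %/ r)%N%:Z in
  let uv := egcdz (s * c + j%:Z * d) (r%:Z * d) in
  (0 < m)%N -> fgcd n c d r j = m ->
  exists A B, [/\ s * c + j%:Z * d = m%:Z * A, r%:Z * d = m%:Z * B &
    uv.1 * A + uv.2 * B = 1].
Proof.
rewrite /=; set a1 := _ + _; set a2 := r%:Z * d => m0 gm.
have m1 : (m%:Z %| a1)%Z by rewrite -gm dvdz_gcdl.
have m2 : (m%:Z %| a2)%Z by rewrite -gm dvdz_gcdr.
exists (a1 %/ m)%Z, (a2 %/ m)%Z; rewrite !(mulrC m%:Z) !divzK //.
split=> //; have mn0 : m%:Z != 0 by rewrite -lt0n in m0 *; lia.
apply: (mulIf mn0); rewrite mulrDl -!mulrA !divzK // mul1r -gm.
by rewrite /fgcd -/a1 -/a2; case: egcdzP.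
Qed.

Lemma hnf_coord_inj (x y : int) (n : nat) (c d : int) (m : nat) :
    (0 < n)%N -> (m %| n)%N -> x * c + y * d = 1 ->
  {in [seq p <- hnf_pairs n | fgcd n c d p.1 p.2 == m%:Z] &,
    injective (hnf_coord x y n c d m)}.
Proof.
move=> n0 mn xy [r j] [r' j']; rewrite !mem_filter !mem_hnf_pairs //=.
move=> /and3P[/eqP gm rn jr] /and3P[/eqP gm' rn' jr'].
have m0 := dvdn_gt0 n0 mn.
have div_gt0 k : (k %| n)%N -> 0 < (n %/ k)%N%:Z.
  by move=> kn; rewrite ltz_nat divn_gt0 ?(dvdn_leq n0 kn) // (dvdn_gt0 n0 kn).
have N0 : (n %/ m)%N%:Z != 0 by rewrite gt_eqF ?div_gt0.
have s0 := div_gt0 r rn; have s'0 := div_gt0 r' rn'.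
rewrite /hnf_coord /= => et.
have [A [B [eA eB uv]]] := fgcd_bezout m0 gm.
have [A' [B' [eA' eB' uv']]] := fgcd_bezout m0 gm'.
have mZ : m%:Z != 0 by lia.
have srn : (n %/ r)%N%:Z * r%:Z = m%:Z * (n %/ m)%N%:Z.
  by rewrite -!PoszM divnK // mulnC divnK.
have srn' : (n %/ r')%N%:Z * r'%:Z = m%:Z * (n %/ m)%N%:Z.
  by rewrite -!PoszM divnK // mulnC divnK.
move: uv uv' et; set s := (n %/ r)%N%:Z in eA srn s0 *.
set s' := (n %/ r')%N%:Z in eA' srn' s'0 *.
case: (egcdz _ _) => u v; case: (egcdz _ _) => u' v' /= uv uv' et.
set N := (n %/ m)%N%:Z in srn srn' et N0.
(* Remainders are nonnegative, so the absolute value in [hnf_coord] loses nothing. *)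
have /eqP : ((u * (s * y - j%:Z * x) - v * (r%:Z * x)) %% N
   = (u' * (s' * y - j'%:Z * x) - v' * (r'%:Z * x)) %% N)%Z.
  by rewrite -[LHS]gez0_abs ?modz_ge0 // et gez0_abs ?modz_ge0.
rewrite eqz_mod_dvd => /dvdzP[e /eqP]; rewrite subr_eq [X in _ == X]addrC => /eqP ee.
have [[i2 [l2 [e1 e2]]] [i [l [e3 e4]]]] :=
  hnf_lattice_sub mZ xy srn srn' eA eB uv eA' eB' uv' ee.
(* Exchanging the two lattices replaces [e] by [- e] and yields the reverse inclusion. *)
have ee' : u' * (s' * y - j'%:Z * x) - v' * (r'%:Z * x) =
    u * (s * y - j%:Z * x) - v * (r%:Z * x) + (- e) * N by rewrite ee; ring.
have [_ [i' [l' [e3' e4']]]] :=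
  hnf_lattice_sub mZ xy srn' srn eA' eB' uv' eA eB uv ee'.
have [] := hnf_unique s0 _ _ s'0 _ _ e3 e4 e3' e4' (etrans srn (esym srn')) e1 e2.
- exact: dvdn_gt0 n0 rn.
- exact: dvdn_gt0 n0 rn'.
- exact: jr.
- exact: jr'.
by move=> [->] [->].
Qed.

Lemma sum_divisors_div (n : nat) : (0 < n)%N ->
  (\sum_(m <- divisors n) n %/ m = \sum_(m <- divisors n) m)%N.
Proof.
move=> n0; rewrite -(big_map (divn n) xpredT id); apply: perm_big.
have nK m : m \in divisors n -> (n %/ (n %/ m))%N = m.
  by rewrite -dvdn_divisors // => mn; rewrite divnA // mulKn.
have dn m : m \in divisors n -> (n %/ m)%N \in divisors n.
  rewrite -!dvdn_divisors // => mn; exact: dvdn_div.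
apply: uniq_perm; [|exact: divisors_uniq|].
  rewrite map_inj_in_uniq ?divisors_uniq // => m1 m2 h1 h2 e.
  by rewrite -(nK _ h1) e nK.
move=> m; apply/mapP/idP => [[m' h ->]|h]; first exact: dn.
by exists (n %/ m)%N; rewrite ?nK ?dn.
Qed.

Lemma count_fgcd (n : nat) (c d : int) (m : nat) :
    (0 < n)%N -> coprimez c d -> (m %| n)%N ->
  count (fun p => fgcd n c d p.1 p.2 == m%:Z) (hnf_pairs n) = (n %/ m)%N.
Proof.
move=> n0 cd mn; pose C k := count (fun p => fgcd n c d p.1 p.2 == k%:Z) (hnf_pairs n).
have C_le m' : m' \in divisors n -> (C m' <= n %/ m')%N.
  rewrite -dvdn_divisors // => mn'; have /coprimezP[[x y] /= xy] := cd.
  rewrite /C -size_filter -(size_map (hnf_coord x y n c d m')).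
  rewrite -[leqRHS](size_iota 0); apply: uniq_leq_size.
    rewrite map_inj_in_uniq ?filter_uniq ?hnf_pairs_uniq //.
    exact: hnf_coord_inj.
  move=> _ /mapP[p _ ->]; rewrite mem_iota /= add0n.
  have N0 : (0 < n %/ m')%N.
    by rewrite divn_gt0 ?(dvdn_leq n0 mn') // (dvdn_gt0 n0 mn').
  rewrite -ltz_nat gez0_abs ?modz_ge0 -?lt0n //.
  by rewrite -[X in _ < X]/(`|(n %/ m')%N%:Z|) ltz_mod // -lt0n.
(* After exchanging the sums, each pair contributes 1 at exactly one divisor, its own gcd, and each
   r carries r pairs. *)
have sumC : (\sum_(m' <- divisors n) C m' = \sum_(m' <- divisors n) n %/ m')%N.
  rewrite sum_divisors_div //; under eq_bigr do rewrite /C -sum1_count big_mkcond.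
  rewrite exchange_big /=.
  transitivity (\sum_(p <- hnf_pairs n) 1)%N.
    apply: eq_big_seq => -[r j]; rewrite mem_hnf_pairs // => /andP[rn _] /=.
    have := fgcd_dvd j cd rn; rewrite /fgcd /gcdz /=; set g := gcdn _ _ => gn.
    have gd : g \in divisors n by rewrite -dvdn_divisors.
    rewrite (bigD1_seq g) ?divisors_uniq //= eqxx big1 ?addn0 // => i.
    by rewrite eqz_nat eq_sym => /negbTE ->.
  rewrite sum1_size size_allpairs_dep sumnE big_map.
  by apply: eq_bigr => r _; rewrite size_iota.
have md : m \in divisors n by rewrite -dvdn_divisors.
have := C_le _ md; move: sumC; rewrite !(bigD1_seq m) ?divisors_uniq //=.
(* With the other terms bounded, equal totals leave no room for a strict inequality at [m]. *)
have : (\sum_(i <- divisors n | i != m) C i <=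
        \sum_(i <- divisors n | i != m) n %/ i)%N.
  rewrite !(big_seq_cond [pred i | i != m]).
  by apply: leq_sum => i /andP[/C_le].
rewrite -/(C m); lia.
Qed.

Lemma fgcd_gt0 (n : nat) (x y : int) (r j : nat) :
  (0 < r)%N -> 0 < y -> 0 < fgcd n x y r j.
Proof.
move=> r0 y0; rewrite lt_neqAle eq_sym andbC; apply/andP; split=> //.
by rewrite gcdz_eq0 negb_and orbC mulf_neq0 //; lia.
Qed.

Lemma ErjE (R : realType) (n : nat) (a b c d : int) (r j : nat) :
    (0 < n)%N -> (r %| n)%N -> 0 < b -> 0 < d -> a * d - b * c != 0 ->
  Erj R n a b c d r j =
    (fgcd n c d r j)%:~R ^+ 2 / n%:R * Eab R a b c d.
Proof.
move=> n0 rn b0 d0 q0; have r0 := dvdn_gt0 n0 rn.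
have k0 : fgcd n a b r j != 0 by rewrite gt_eqF // fgcd_gt0.
have m0 : fgcd n c d r j != 0 by rewrite gt_eqF // fgcd_gt0.
rewrite /Erj /Eab /fq.
have ea : fnum n a b r j * fgcd n a b r j = (n %/ r)%N%:Z * a + j%:Z * b.
  by rewrite divzK // dvdz_gcdl.
have eb : fden n a b r j * fgcd n a b r j = r%:Z * b by rewrite divzK // dvdz_gcdr.
have ec : fnum n c d r j * fgcd n c d r j = (n %/ r)%N%:Z * c + j%:Z * d.
  by rewrite divzK // dvdz_gcdl.
have ed : fden n c d r j * fgcd n c d r j = r%:Z * d by rewrite divzK // dvdz_gcdr.
have srn : (n %/ r)%N%:Z * r%:Z = n%:Z by rewrite -PoszM divnK.
move: ea eb ec ed k0 m0; set k := fgcd n a b r j; set m := fgcd n c d r j.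
set A := fnum n a b r j; set B := fden n a b r j.
set C := fnum n c d r j; set D := fden n c d r j => ea eb ec ed k0 m0.
have eq : (A * D - B * C) * (k * m) = n%:Z * (a * d - b * c).
  transitivity ((A * k) * (D * m) - (B * k) * (C * m)); first by ring.
  by rewrite ea eb ec ed -srn; ring.
have D0 : D != 0.
  by apply: contraTneq r0 => D0; move: ed; rewrite D0 mul0r; nia.
have Q0 : A * D - B * C != 0.
  apply: contra_neq q0 => Q0; move/eqP: eq; rewrite Q0 mul0r eq_sym mulf_eq0.
  by move=> /orP[|/eqP//]; lia.
have nE : (n%:R : R) = (n%:Z)%:~R by [].
have IR (z : int) : z != 0 -> (z%:~R : R) != 0 by rewrite intr_eq0.
have nZ : n%:Z != 0 by lia.
rewrite nE -rmorphXn mulrACA -invfM -!rmorphM /=.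
apply/eqP; rewrite eqr_div ?IR ?mulf_neq0 //; last by lia.
rewrite -!rmorphM eqr_int; apply/eqP.
(* The factor [k r] makes [B k = r b] and [r d = D m] applicable. *)
have rk0 : k * r%:Z != 0 by rewrite mulf_neq0 //; lia.
apply: (mulIf rk0).
transitivity ((B * k) * (n%:Z * (a * d - b * c)) * (r%:Z * d)); first by ring.
by rewrite -eq eb -ed; ring.
Qed.

Theorem theorem2 (R : realType) (n : nat) (a b c d : int) (alpha : R)
    (hb : 4 <= b) (hn : (1 <= n)%N)
    (hd : 0 < d) (hdb : d%:~R < (b%:~R : R) `^ (1 / 3))
    (hc : 0 <= c < d) (hcd : coprimez c d)
    (halpha : alpha = Num.sqrt (b%:~R / d%:~R ^+ 3))
    (halphan : n%:R `^ (3 / 2) + n%:R <= alpha)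
    (hab : coprimez a b)
    (ha : 0 < (a%:~R : R) - b%:~R * (c%:~R / d%:~R) <= alpha / n%:R - 1) :
  (forall r j : nat, (r %| n)%N -> (j < r)%N -> (fgcd n c d r j %| n%:Z)%Z) /\
  (forall m : nat, (m %| n)%N ->
    ([set p : nat * nat | [/\ (p.1 %| n)%N, (p.2 < p.1)%N &
       Erj R n a b c d p.1 p.2 = m%:R ^+ 2 / n%:R * Eab R a b c d]]
      #= `I_(n %/ m)%N)%card).
Proof.
split=> [r j rn _|m mn]; first exact: fgcd_dvd.
have b0 : 0 < b by lia.
have q0 : a * d - b * c != 0.
  have dR : (d%:~R : R) != 0 by rewrite intr_eq0; lia.
  have /andP[+ _] := ha; apply: contraTneq => /eqP; rewrite subr_eq0 => /eqP e.
  suff -> : (a%:~R : R) = b%:~R * (c%:~R / d%:~R) by rewrite subrr ltxx.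
  by rewrite mulrA -rmorphM -e rmorphM mulfK.
have E0 : Eab R a b c d != 0.
  by rewrite mulf_neq0 ?invr_eq0 ?intr_eq0 ?mulf_neq0 //; lia.
set s := [seq p <- hnf_pairs n | fgcd n c d p.1 p.2 == m%:Z].
have -> : [set p : nat * nat | [/\ (p.1 %| n)%N, (p.2 < p.1)%N &
    Erj R n a b c d p.1 p.2 = m%:R ^+ 2 / n%:R * Eab R a b c d]]
    = [set` [fset p in s]%fset].
  apply/seteqP; split=> [[r j] [/= rn jr]|[r j]] /=.
    have n0 : (n%:R : R)^-1 != 0 by rewrite invr_eq0 pnatr_eq0 -lt0n.
    rewrite ErjE // => /(mulIf E0) /(mulIf n0) /eqP.
    (* What remains equates the squares of two nonnegative integers, the gcd and [m]. *)
    rewrite -[m%:R]/(m%:Z%:~R) eqrXn2 ?ler0z // eqr_int => e.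
    by rewrite in_fset /= mem_filter mem_hnf_pairs //= rn jr e.
  rewrite in_fset /= mem_filter mem_hnf_pairs //= => /and3P[/eqP e rn jr].
  by split=> //; rewrite ErjE // e.
apply/card_eq_fsetP; rewrite -(count_fgcd hn hcd mn) -size_filter -/s.
by rewrite card_fseq undup_id // filter_uniq // hnf_pairs_uniq.
Qed.
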